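(* Let $(x_n)_{n\ge 0}$ be the sequence of positive integers defined by $x_0=x_1=1$ and $x_{n+2}x_n=x_{n+1}^2(x_n+1)$ for $n\ge 0$. Then $$\left[0;1,1,1,x_1,x_2,x_3,x_4,x_5,\ldots,x_n,\ldots\right]=\sum_{n=1}^{\infty}\frac{(-1)^{n-1}}{x_n}.$$
   Context: $[c_0;c_1,c_2,\ldots]$ denotes the regular continued fraction $c_0+\cfrac{1}{c_1+\cfrac{1}{c_2+\cdots}}$. Here $c_0=0$, $c_1=c_2=c_3=1$, and $c_{k+3}=x_k$ for $k\ge 1$. *)

(* Defs.v *)
From Stdlib Require Import Reals Lia.
From Coquelicot Require Import Coquelicot.
Open Scope R_scope.

(* [cf_segment c k n] is the finite continued fraction
   c_k + 1/(c_{k+1} + 1/(... + 1/c_{k+n})). *)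
Fixpoint cf_segment (c : nat -> nat) (k n : nat) : R :=
  match n with
  | O => INR (c k)
  | S m => INR (c k) + / cf_segment c (S k) m
  end.

Definition cf_convergent (c : nat -> nat) (n : nat) : R := cf_segment c 0 n.

(* The infinite continued fraction [c_0; c_1, c_2, ...] converges to [l]. *)
Definition is_cfrac (c : nat -> nat) (l : R) : Prop :=
  is_lim_seq (cf_convergent c) l.

Definition is_xseq (x : nat -> nat) : Prop :=
  (forall n, (0 < x n)%nat) /\ x 0%nat = 1%nat /\ x 1%nat = 1%nat /\
  forall n, (x (n + 2) * x n = x (n + 1) ^ 2 * (x n + 1))%nat.

Definition cf_coef (x : nat -> nat) (k : nat) : nat :=
  match k with
  | 0 => 0
  | 1 | 2 | 3 => 1
  | S (S (S j)) => x j
  end.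

(* The recurrence prescribes a quotient, so the existence of an integer
   solution is not immediate: put y_n = x_{n+1} / x_n; then
   x_{n+1} = x_n * y_n and y_{n+1} = y_n * (x_n + 1). *)
Fixpoint xy (n : nat) : nat * nat :=
  match n with
  | O => (1, 1)%nat
  | S m => let (a, b) := xy m in (a * b, b * (a + 1))%nat
  end.

Lemma is_xseq_exists : exists x : nat -> nat, is_xseq x.
Proof.
  exists (fun n => fst (xy n)).
  assert (pos : forall n, (0 < fst (xy n) /\ 0 < snd (xy n))%nat).
  { induction n as [|n IH]; simpl; [lia|].
    destruct (xy n) as [a b]; simpl in *; nia. }
  repeat split.
  - intro n; apply pos.
  - intro n.
    replace (n + 2)%nat with (S (S n)) by lia.
    replace (n + 1)%nat with (S n) by lia.
    simpl; destruct (xy n) as [a b]; simpl; ring.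
Qed.

(* Main.v *)
Require Import Defs.
From Stdlib Require Import Reals Lra Lia.
From Coquelicot Require Import Coquelicot.
Open Scope R_scope.

(** Let [p_n / q_n] be the convergents of the continued fraction. The recurrence
    for [x] says exactly that the denominators satisfy [q_n - q_(n-1) = x_m]
    for the partial quotient [x_m] that comes next. Hence the partial sum of the
    series up to [1 / x_m] is the quotient
    [(p_n - p_(n-1)) / (q_n - q_(n-1))], because consecutive quotients of this
    form differ by [(-1)^(m-1) / x_m], by the determinant identity. The same
    identity shows that this quotient differs from [p_n / q_n] by
    [1 / (q_n x_m)] in absolute value. *)

(* Indices are shifted by two: for [c = [c_0; c_1, ...]], the n-th convergent is
   [continuant 0 1 c (n + 2) / continuant 1 0 c (n + 2)]. *)
Fixpoint continuant (u v : R) (c : nat -> nat) (n : nat) : R :=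
  match n with
  | O => u
  | S m =>
      match m with
      | O => v
      | S k => INR (c k) * continuant u v c m + continuant u v c k
      end
  end.

Lemma continuant_SS (u v : R) (c : nat -> nat) (n : nat) :
  continuant u v c (S (S n)) =
  INR (c n) * continuant u v c (S n) + continuant u v c n.
Proof. reflexivity. Qed.

Lemma continuant_det (c : nat -> nat) (n : nat) :
  continuant 0 1 c (S n) * continuant 1 0 c n -
  continuant 0 1 c n * continuant 1 0 c (S n) = (-1) ^ n.
Proof.
  induction n as [|n IH]; [simpl; ring|].
  rewrite !continuant_SS; simpl pow; rewrite <- IH; ring.
Qed.

Lemma cf_segment_pos (c : nat -> nat) (k n : nat) :
  (forall i, (k <= i)%nat -> (0 < c i)%nat) -> 0 < cf_segment c k n.
Proof.
  revert k; induction n as [|n IH]; intros k hc; simpl.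
  - apply lt_0_INR; auto.
  - apply Rplus_lt_0_compat.
    + apply lt_0_INR; auto.
    + apply Rinv_0_lt_compat, IH; intros i hi; apply hc; lia.
Qed.

(** The tail acts as a complete quotient. Each step of the induction on [n] moves one partial
    quotient from the tail into the continuants, so [m] stays general. Only tails starting after
    [c 0] get inverted, so [c 0] may vanish. *)
Lemma cf_segment_continuant (c : nat -> nat) (n m : nat) :
  (forall i, (0 < c (S i))%nat) ->
  cf_segment c 0 (n + m) =
  (continuant 0 1 c (S n) * cf_segment c n m + continuant 0 1 c n) /
  (continuant 1 0 c (S n) * cf_segment c n m + continuant 1 0 c n).
Proof.
  intro hc; revert m; induction n as [|n IH]; intro m.
  - simpl; field.
  - replace (S n + m)%nat with (n + S m)%nat by lia.
    rewrite IH, !continuant_SS.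
    change (cf_segment c n (S m)) with (INR (c n) + / cf_segment c (S n) m).
    assert (hz : 0 < cf_segment c (S n) m).
    { apply cf_segment_pos; intros [|i] hi; [lia|apply hc]. }
    set (z := cf_segment c (S n) m) in *.
    (* Scaling by [z] lets numerators and denominators be compared separately, so only [z <> 0] has
       to be known. *)
    rewrite <- (Rdiv_mult_l_l z) by lra.
    f_equal; field; lra.
Qed.

Lemma cf_convergent_continuant (c : nat -> nat) (n : nat) :
  (forall i, (0 < c (S i))%nat) ->
  cf_convergent c n =
  continuant 0 1 c (S (S n)) / continuant 1 0 c (S (S n)).
Proof.
  intro hc; unfold cf_convergent.
  rewrite <- (Nat.add_0_r n) at 1.
  rewrite (cf_segment_continuant c n 0 hc), !continuant_SS; simpl cf_segment.
  f_equal; ring.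
Qed.

Section XSequence.

Variable x : nat -> nat.
Hypothesis hx : is_xseq x.

Let P := continuant 0 1 (cf_coef x).
Let Q := continuant 1 0 (cf_coef x).

Lemma INR_xseq_ge_1 (n : nat) : 1 <= INR (x n).
Proof. apply (le_INR 1); destruct hx as [h _]; apply h. Qed.

(* The partial quotient [c_3 = 1] equals [x_0], so no case split is needed. *)
Lemma cf_coef_add3 (n : nat) : cf_coef x (S (S (S n))) = x n.
Proof. destruct n; [symmetry; apply hx | reflexivity]. Qed.

Lemma cf_coef_pos (n : nat) : (0 < cf_coef x (S n))%nat.
Proof. destruct n as [|[|n]]; [simpl; lia..|rewrite cf_coef_add3; apply hx]. Qed.

Lemma continuant_xseq (u v : R) (n : nat) :
  continuant u v (cf_coef x) (5 + n) =
  INR (x n) * continuant u v (cf_coef x) (4 + n) +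
  continuant u v (cf_coef x) (3 + n).
Proof.
  change (5 + n)%nat with (S (S (3 + n))).
  rewrite continuant_SS.
  change (3 + n)%nat with (S (S (S n))) at 1.
  now rewrite cf_coef_add3.
Qed.

(** The second equation identifies [Q (4 + n) - 1] with the ratio of consecutive terms. The
    recurrence for [x] multiplies this ratio by [x n + 1]; given the first equation, so does the
    continuant recurrence. Each equation feeds the other's step, hence the joint induction. *)
Lemma xseq_denominators (n : nat) :
  INR (x n) = Q (4 + n) - Q (3 + n) /\
  INR (x (S n)) = INR (x n) * (Q (4 + n) - 1).
Proof.
  destruct hx as (_ & h0 & h1 & hrec).
  induction n as [|n [IH1 IH2]].
  - rewrite h0, h1; unfold Q; simpl; lra.
  - pose proof (continuant_xseq 1 0 n) as hQ; fold Q in hQ.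
    pose proof (INR_xseq_ge_1 n) as hn.
    specialize (hrec n).
    rewrite (Nat.add_comm n 2), (Nat.add_comm n 1) in hrec.
    apply (f_equal INR) in hrec.
    rewrite !mult_INR, pow_INR, plus_INR in hrec; simpl Nat.add in *.
    simpl INR in hrec.
    split; [rewrite hQ, IH2; lra|].
    apply (Rmult_eq_reg_r (INR (x n))); [|lra].
    rewrite hrec, hQ.
    transitivity (INR (x (S n)) * (INR (x n) * (Q (S (S (S (S n)))) - 1) * (INR (x n) + 1))).
    { rewrite <- IH2; ring. }
    replace (Q (S (S (S n)))) with (Q (S (S (S (S n)))) - INR (x n)) by lra.
    ring.
Qed.

Lemma denominator_lower_bound (n : nat) : 2 + INR n <= Q (4 + n).
Proof.
  induction n as [|n IH]; [unfold Q; simpl; lra|].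
  pose proof (proj1 (xseq_denominators (S n))) as h.
  pose proof (INR_xseq_ge_1 (S n)).
  rewrite S_INR.
  replace (3 + S n)%nat with (4 + n)%nat in h by lia; lra.
Qed.

(** From [x 1] on, each term is the previous one times some [Q - 1], and the linear bound on [Q]
    makes this factor at least 2. *)
Lemma xseq_growth (n : nat) : 2 ^ n <= INR (x (S n)).
Proof.
  induction n as [|n IH]; [apply INR_xseq_ge_1|].
  rewrite (proj2 (xseq_denominators (S n))).
  pose proof (denominator_lower_bound (S n)) as h.
  pose proof (pos_INR n).
  pose proof (INR_xseq_ge_1 (S n)).
  rewrite S_INR in h; simpl pow; nra.
Qed.

Lemma consecutive_det (n : nat) :
  P (3 + n) * Q (4 + n) - P (4 + n) * Q (3 + n) = (-1) ^ n.
Proof.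
  pose proof (continuant_det (cf_coef x) (3 + n)) as h.
  fold P Q in h; rewrite pow_add in h.
  simpl Nat.add in *; simpl pow in h; lra.
Qed.

Definition xseq_term (k : nat) : R := (-1) ^ k / INR (x (k + 1)%nat).

Lemma partial_sum_difference (n : nat) :
  (P (5 + n) - P (4 + n)) / INR (x (S n)) -
  (P (4 + n) - P (3 + n)) / INR (x n) = xseq_term n.
Proof.
  unfold xseq_term; rewrite (Nat.add_comm n 1); simpl (1 + n)%nat.
  pose proof (INR_xseq_ge_1 n) as h0.
  pose proof (INR_xseq_ge_1 (S n)) as h1.
  assert (hS : INR (x (S n)) = Q (5 + n) - Q (4 + n))
    by apply (proj1 (xseq_denominators (S n))).
  pose proof (proj1 (xseq_denominators n)) as hn.
  (* Cross-multiplied form: expanding index [5 + n] leaves [x n] times the determinant of the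
     columns [3 + n] and [4 + n]. *)
  assert (key : (P (5 + n) - P (4 + n)) * INR (x n) -
                (P (4 + n) - P (3 + n)) * INR (x (S n)) = INR (x n) * (-1) ^ n).
  { rewrite <- consecutive_det, hS; unfold P, Q in *.
    rewrite !continuant_xseq, hn; ring. }
  apply (Rmult_eq_reg_r (INR (x n) * INR (x (S n)))); [|nra].
  transitivity (INR (x n) * (-1) ^ n); [rewrite <- key|]; field; lra.
Qed.

Lemma xseq_partial_sum (n : nat) :
  sum_n xseq_term n = (P (5 + n) - P (4 + n)) / INR (x (S n)) :> R.
Proof.
  induction n as [|n IH].
  - rewrite sum_O, <- partial_sum_difference.
    (* The telescoping starts from zero because [P 3] and [P 4] are both 1. *)
    replace (P (4 + 0) - P (3 + 0)) with 0 by (unfold P; simpl; ring).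
    unfold Rdiv; ring.
  - rewrite sum_Sn, IH, <- partial_sum_difference.
    change plus with Rplus; simpl Nat.add; ring.
Qed.

(** The convergent [n + 3] ends with the quotient [x n], while the sum already reaches the term with
    denominator [x (n + 1)]. *)
Lemma cf_convergent_xseq (n : nat) :
  cf_convergent (cf_coef x) (n + 3) =
  sum_n xseq_term n - xseq_term n / Q (5 + n).
Proof.
  rewrite cf_convergent_continuant by apply cf_coef_pos.
  replace (S (S (n + 3))) with (5 + n)%nat by lia.
  rewrite xseq_partial_sum.
  fold P Q.
  unfold xseq_term; rewrite (Nat.add_comm n 1); simpl (1 + n)%nat.
  assert (hdet : P (4 + n) * Q (5 + n) - P (5 + n) * Q (4 + n) = - (-1) ^ n).
  { pose proof (consecutive_det (S n)) as h; simpl in h |- *; lra. }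
  assert (hS : INR (x (S n)) = Q (5 + n) - Q (4 + n))
    by apply (proj1 (xseq_denominators (S n))).
  pose proof (INR_xseq_ge_1 (S n)) as h1.
  assert (hQ : 2 + INR (S n) <= Q (5 + n)) by apply (denominator_lower_bound (S n)).
  pose proof (pos_INR (S n)).
  replace ((-1) ^ n) with (P (5 + n) * Q (4 + n) - P (4 + n) * Q (5 + n)) by lra.
  rewrite hS in *; field; lra.
Qed.

Lemma Rabs_xseq_term (n : nat) : Rabs (xseq_term n) = / INR (x (S n)).
Proof.
  unfold xseq_term; rewrite (Nat.add_comm n 1); simpl (1 + n)%nat.
  pose proof (INR_xseq_ge_1 (S n)).
  unfold Rdiv; rewrite Rabs_mult, pow_1_abs, Rmult_1_l.
  apply Rabs_pos_eq, Rlt_le, Rinv_0_lt_compat; lra.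
Qed.

Lemma ex_series_xseq : ex_series xseq_term.
Proof.
  apply (ex_series_le xseq_term (fun n => (/ 2) ^ n)).
  - intro n; change (norm (xseq_term n)) with (Rabs (xseq_term n)).
    rewrite Rabs_xseq_term, pow_inv.
    apply Rinv_le_contravar; [apply pow_lt; lra|apply xseq_growth].
  - apply ex_series_geom; rewrite Rabs_pos_eq; lra.
Qed.

(** The numerators already tend to 0, as terms of a convergent series; it is enough that the
    denominators are at least 1. *)
Lemma xseq_error_lim : is_lim_seq (fun n => xseq_term n / Q (5 + n)) 0.
Proof.
  apply is_lim_seq_abs_0.
  apply (is_lim_seq_le_le (fun _ => 0) _ (fun n => Rabs (xseq_term n))).
  - intro n; split; [apply Rabs_pos|].
    assert (hQ : 2 + INR (S n) <= Q (5 + n)) by apply (denominator_lower_bound (S n)).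
    pose proof (pos_INR (S n)).
    unfold Rdiv; rewrite Rabs_mult.
    rewrite <- (Rmult_1_r (Rabs (xseq_term n))) at 2.
    apply Rmult_le_compat_l; [apply Rabs_pos|].
    rewrite Rabs_pos_eq by (apply Rlt_le, Rinv_0_lt_compat; lra).
    rewrite <- Rinv_1; apply Rinv_le_contravar; lra.
  - apply is_lim_seq_const.
  - apply (proj1 (is_lim_seq_abs_0 _)).
    apply ex_series_lim_0, ex_series_xseq.
Qed.

End XSequence.

Theorem mainTheorem7 (x : nat -> nat) (hx : is_xseq x) :
  exists l : R,
    is_cfrac (cf_coef x) l /\
    is_series (fun k : nat => (-1) ^ k / INR (x (k + 1)%nat)) l.
Proof.
  destruct (ex_series_xseq x hx) as [l hl].
  exists l; split; [|exact hl].
  apply (is_lim_seq_incr_n _ 3).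
  eapply is_lim_seq_ext.
  { intro n; symmetry; apply (cf_convergent_xseq x hx). }
  replace (Finite l) with (Finite (l - 0)) by (f_equal; ring).
  apply is_lim_seq_minus'; [exact hl|apply (xseq_error_lim x hx)].
Qed.
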